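(* Let $\mathcal{S}$ be a $t$-semiarc in the Desarguesian projective plane $\mathrm{PG}(2,q)$. If some line meets $\mathcal{S}$ in exactly $q+1-t$ points, then $t\geq (q-1)/2$. Moreover, if $t=(q-1)/2$, then $\mathcal{S}$ is a blocking set of Rédei type and every line meeting $\mathcal{S}$ in exactly $q+1-t$ points is a Rédei line of $\mathcal{S}$.
   Context: A non-empty point set $\mathcal{S}$ of a projective plane of order $q$ is a $t$-semiarc if for every point $P\in\mathcal{S}$ there are exactly $t$ lines $\ell$ with $\ell\cap\mathcal{S}=\{P\}$ (tangents at $P$). A blocking set is a point set meeting every line; it is non-trivial if it contains no line. A non-trivial blocking set $\mathcal{B}$ is of Rédei type if there is a line $\ell$ with $|\ell\cap\mathcal{B}|=|\mathcal{B}|-q$; such a line is called a Rédei line of $\mathcal{B}$.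
   Formalization: The hypothesis t ≥ 1 is added, since for t = 0 the claim is false: the whole plane is a 0-semiarc that every line meets in q+1 points, but 0 < (q−1)/2. *)

(* Defs.v *)
From HB Require Import structures.
From mathcomp Require Import all_boot all_order all_algebra.

Set Implicit Arguments.
Unset Strict Implicit.
Unset Printing Implicit Defensive.

(* The subspaces of a finite-dimensional space over a finite field form a
   finType, so that sets of points of PG(2, q) are values of type {set _}. *)
Section FiniteVspace.

Import VectorInternalTheory.

Variables (F : finFieldType) (vT : vectType F).

HB.instance Definition _ := [Countable of {vspace vT} by <:].
HB.instance Definition _ := [Finite of {vspace vT} by <:].

End FiniteVspace.

(* PG(2, q) with q = #|F|: points and lines are the subspaces of F^3 of
   vector-space dimension 1 and 2, and incidence is inclusion. *)
Section ProjectivePlane.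

Variable F : finFieldType.

Definition pg2_point := {U : {vspace 'rV[F]_3} | \dim U == 1}.
Definition pg2_line := {U : {vspace 'rV[F]_3} | \dim U == 2}.

Implicit Types (P : pg2_point) (l : pg2_line) (S B : {set pg2_point}).

Definition points_on l : {set pg2_point} :=
  [set P : pg2_point | (val P <= val l)%VS].

Definition tangents S P : {set pg2_line} :=
  [set l | points_on l :&: S == [set P]].

Definition semiarc (t : nat) S : Prop :=
  S != set0 /\ forall P, P \in S -> #|tangents S P| = t.

Definition blocking_set B : Prop :=
  forall l, exists2 P, P \in B & P \in points_on l.

Definition nontrivial_blocking_set B : Prop :=
  blocking_set B /\ forall l, ~~ (points_on l \subset B).

(* |l :&: B| = |B| - q, written without truncated subtraction. *)
Definition Redei_line B l : Prop := #|points_on l :&: B| + #|F| = #|B|.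

Definition Redei_type B : Prop :=
  nontrivial_blocking_set B /\ exists l, Redei_line B l.

End ProjectivePlane.

(* Main.v *)
Require Import Defs.
From HB Require Import structures.
From mathcomp Require Import all_boot all_order all_algebra all_field.
From mathcomp Require Import zify ring.

(* Let l be a (q+1-t)-secant, taken as the line at infinity, U = S \ l in the
   affine plane, D the directions in S and N the t remaining ones.  Every line
   through a point of U and a direction of D is not a tangent, so all t tangents
   at a point of U go through N: a line through N meets U at most once, whereas
   exactly r = q - t lines through each direction of D meet U.

   Dually, U is a set of lines X + aY - b = 0, with product H.  Lacunarity of
   H(X,y) for y in N produces a curve R of degree r such that R(X,y) divides
   H(X,y) for all y in D, and dividing H by R produces polynomials W, V of degree
   d = |U| - r, with W monic in X and V = aW on every line of U: the vector
   field W d/dY - V d/dX leaves these lines invariant.  The construction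
   distinguishes the direction of D chosen at infinity in the dual plane.  Two
   different choices give two foliations which are tangent to each other along
   a curve Psi of degree 2d+1, and Psi is monic in X, hence nonzero.  It contains
   the lines of U, so |U| <= 2d+1, i.e. 2(q-t) <= |U| + 1; finally |U| <= q. *)

Set Implicit Arguments.
Unset Strict Implicit.
Unset Printing Implicit Defensive.

Import GRing.Theory.
Local Open Scope ring_scope.

(** * Bivariate polynomials of bounded total degree *)

Section TotalDegree.

Variable F : fieldType.
Implicit Types (p q : {poly {poly F}}) (m n : nat).

(* [p : F[Y][X]] has total degree at most [m]; the truncated subtraction
   makes the coefficients of [X^i] vanish for [i > m]. *)
Definition tdeg_le m p : Prop := forall i, (size (p`_i)%R <= m.+1 - i)%N.

Lemma tdeg_le_size m p : tdeg_le m p -> (size p <= m.+1)%N.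
Proof.
move=> pm; apply/leq_sizeP => j jm; apply/eqP; rewrite -size_poly_leq0.
by have := pm j; lia.
Qed.

Lemma tdeg_leW m n p : (m <= n)%N -> tdeg_le m p -> tdeg_le n p.
Proof. by move=> mn pm i; apply: leq_trans (pm i) _; lia. Qed.

Lemma tdeg_leB m p q : tdeg_le m p -> tdeg_le m q -> tdeg_le m (p - q).
Proof.
move=> pm qm i; rewrite coefB (leq_trans (size_polyD _ _)) // size_polyN.
by rewrite geq_max pm qm.
Qed.

Lemma tdeg_leZ m (c : F) p : tdeg_le m p -> tdeg_le m (c%:P *: p).
Proof.
move=> pm i; rewrite coefZ mul_polyC.
exact: leq_trans (size_scale_leq _ _) (pm i).
Qed.

Lemma tdeg_leM m n p q : tdeg_le m p -> tdeg_le n q -> tdeg_le (m + n) (p * q).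
Proof.
move=> pm qn i; rewrite coefM (leq_trans (size_sum _ _ _)) //.
apply/bigmax_leqP => j _; have := pm j; have := qn (i - j)%N.
have [->|pj] := eqVneq p`_j 0; first by rewrite mul0r size_poly0.
have [->|qj] := eqVneq q`_(i - j)%N 0; first by rewrite mulr0 size_poly0.
move: pj qj; rewrite -!size_poly_gt0 => pj qj.
move=> qs ps; apply: leq_trans (size_polyMleq _ _) _; have := ltn_ord j; move: pj qj qs ps; move: (size p`_j) (size q`_(i - j)%N) => a b; lia.
Qed.

Lemma tdeg_le_Xn n : tdeg_le n 'X^n.
Proof.
move=> i; rewrite coefXn; case: eqP => [->|_]; last by rewrite size_poly0.
by rewrite size_poly1; lia.
Qed.

Lemma tdeg_le_prod_XsubC (I : Type) (s : seq I) (g : I -> {poly F}) :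
  (forall i, size (g i) <= 2)%N ->
  tdeg_le (size s) (\prod_(i <- s) ('X - (g i)%:P)).
Proof.
move=> gs; elim: s => [|i s IHs].
  by rewrite big_nil -(expr0 'X); apply: tdeg_le_Xn.
rewrite big_cons -[size _]/(1 + size s)%N; apply: tdeg_leM => // j.
rewrite coefB coefX coefC; case: j => [|[|j]] /=.
- by rewrite sub0r size_polyN gs.
- by rewrite subr0 size_poly1.
- by rewrite subr0 size_poly0.
Qed.

(** Long division in X by a polynomial that is monic in X and whose total degree is its X-degree.
    The coefficient of X^j in [p] has Y-degree at most m - j, so each quotient term has total degree
    at most m - n and each subtraction stays within [m]. *)
Lemma tdeg_le_divE m n p q : (n <= m)%N -> q \is monic -> size q = n.+1 ->
    tdeg_le n q -> tdeg_le m p ->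
  exists d r : {poly {poly F}}, [/\ p = d * q + r, (size r <= n)%N, tdeg_le (m - n) d
                & tdeg_le m r].
Proof.
move=> nm qmon qsize qn.
have [k] := ubnP (size p); elim: k p => // k IHk p pk pm.
have [pn|np] := leqP (size p) n.
  exists 0, p; split=> //; first by rewrite mul0r add0r.
  by move=> i; rewrite coef0 size_poly0.
set j := (size p).-1; set t : {poly {poly F}} := p`_j *: 'X^(j - n).
have jn : (n <= j)%N by rewrite /j; lia.
have tm : tdeg_le (m - n) t.
  move=> i; rewrite coefZ coefXn; case: eqP => [->|_].
    by rewrite mulr1; have := pm j; lia.
  by rewrite mulr0 size_poly0.
have tqm : tdeg_le m (t * q) by rewrite -(subnK nm); apply: tdeg_leM.
have sp : (size (p - t * q)%R < k)%N.
  apply: (@leq_ltn_trans j); last by rewrite /j; lia.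
  have st : (size (t * q)%R <= j.+1)%N.
    rewrite /t -scalerAl (leq_trans (size_scale_leq _ _)) //.
    by rewrite mulrC size_mulXn ?monic_neq0 // qsize; lia.
  apply/leq_sizeP => i; rewrite leq_eqVlt => /predU1P[<-|ji].
    rewrite coefB /t -scalerAl coefZ mulrC mulrC coefXnM.
    rewrite ltnNge leq_subr /= subKn //.
    by have := monicP qmon; rewrite lead_coefE qsize /= => ->; rewrite mulr1 subrr.
  rewrite coefB !nth_default ?subrr //; first exact: leq_trans st _.
  exact: leq_trans (leqSpred _) ji.
have [d [r [dr rn dm rm]]] := IHk _ sp (tdeg_leB pm tqm).
exists (t + d), r; split=> //.
  by rewrite mulrDl -addrA -dr addrC subrK.
move=> i; have -> : t + d = t - (- d) by rewrite opprK.
apply: tdeg_leB => // l; by rewrite coefN size_polyN.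
Qed.

Lemma monic_divE m n p q d r : (n <= m)%N -> p \is monic -> size p = m.+1 ->
    q \is monic -> size q = n.+1 -> p = d * q + r -> (size r <= n)%N ->
  d \is monic /\ size d = (m - n).+1.
Proof.
move=> nm pmon ps qmon qs pE rn.
have dqE : d * q = p - r by rewrite pE addrK.
have rp : (size (- r)%R < size p)%N by rewrite size_polyN ps ltnS (leq_trans rn nm).
have lead : lead_coef (d * q) = 1 by rewrite dqE lead_coefDl // (monicP pmon).
have dmon : d \is monic.
  by apply/monicP; rewrite -lead lead_coefM (monicP qmon) mulr1.
have sd : (0 < size d)%N by rewrite size_poly_gt0 monic_neq0.
split=> //; have := size_polyDl rp; rewrite -dqE ps size_monicM ?monic_neq0 // qs.
by move: (size d) sd => s; lia.
Qed.

(** * Specialization of the inner variable Y *)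

Definition eval_inner (c : F) : {poly {poly F}} -> {poly F} :=
  map_poly (horner_eval c).

HB.instance Definition _ c := GRing.RMorphism.copy (eval_inner c)
  (map_poly (horner_eval c)).

Lemma coef_eval_inner c p i : (eval_inner c p)`_i = (p`_i).[c].
Proof. by rewrite coef_map. Qed.

Lemma horner_eval_inner c p g : (eval_inner c p).[g.[c]] = p.[g].[c].
Proof. by rewrite -[g.[c]]/(horner_eval c g) horner_map. Qed.

Lemma eval_innerX c : eval_inner c 'X = 'X.
Proof. exact: map_polyX. Qed.

Lemma eval_innerB c p q : eval_inner c (p - q) = eval_inner c p - eval_inner c q.
Proof. exact: rmorphB. Qed.

Lemma eval_innerD c p q : eval_inner c (p + q) = eval_inner c p + eval_inner c q.
Proof. exact: rmorphD. Qed.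

Lemma eval_innerM c p q : eval_inner c (p * q) = eval_inner c p * eval_inner c q.
Proof. exact: rmorphM. Qed.

Lemma eval_innerXn c n : eval_inner c 'X^n = 'X^n.
Proof. exact: map_polyXn. Qed.

Lemma eval_innerZ c g p : eval_inner c (g *: p) = g.[c] *: eval_inner c p.
Proof. by apply/polyP => i; rewrite coefZ !coef_eval_inner coefZ hornerM. Qed.

Lemma eval_inner_monic c p : p \is monic ->
  eval_inner c p \is monic /\ size (eval_inner c p) = size p.
Proof.
move=> pm; split; first exact: monic_map.
by rewrite size_map_poly_id0 // (monicP pm) rmorph1 oner_neq0.
Qed.

Lemma size_eval_inner c p : (size (eval_inner c p) <= size p)%N.
Proof. exact: size_poly. Qed.

Lemma eval_inner_prod_XsubC c (I : Type) (s : seq I) (g : I -> {poly F}) :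
  eval_inner c (\prod_(i <- s) ('X - (g i)%:P)) =
  \prod_(i <- s) ('X - (g i).[c]%:P).
Proof.
rewrite rmorph_prod; apply: eq_bigr => i _.
by rewrite rmorphB /= eval_innerX /eval_inner map_polyC.
Qed.

(** Each coefficient of a power of X is a polynomial in Y vanishing on [s]; it is divisible by the
    product of the Y - c, and its degree drops by the size of [s]. *)
Lemma eval_inner_eq0_divE m (s : seq F) p : uniq s -> tdeg_le m p ->
    {in s, forall c, eval_inner c p = 0} ->
  exists2 d, p = \prod_(c <- s) ('X - c%:P) *: d & tdeg_le (m - size s) d.
Proof.
move=> us pm ps; set P := \prod_(c <- s) _.
have Ps : size P = (size s).+1 by rewrite size_prod_XsubC.
have P0 : P != 0 by rewrite -size_poly_gt0 Ps.
have d0 : 0 %/ P = 0 by rewrite div0p.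
exists (map_poly (fun g => g %/ P) p).
  apply/polyP => i; rewrite coefZ coef_map_id0 // mulrC divpK //.
  apply: uniq_roots_dvdp; last by rewrite uniq_rootsE.
  by apply/allP => c cs; rewrite rootE -coef_eval_inner ps // coef0.
move=> i; rewrite coef_map_id0 // size_divp // Ps /=.
by apply: leq_trans (leq_sub2r _ (pm i)) _; lia.
Qed.

End TotalDegree.

(** * The foliation attached to a set with few directions *)

Section RedeiPolynomial.

Variable F : finFieldType.
Implicit Types (u : F * F) (U : {set F * F}) (N : {set F}) (c x : F).

Lemma sqr_XsubC_ndvd_genPoly x : ~~ (('X - x%:P) ^+ 2 %| 'X^#|F| - 'X).
Proof.
rewrite finField_genPoly (bigD1 x) //= expr2 dvdp_mul2l ?polyXsubC_eq0 //.
rewrite dvdp_XsubCl rootE horner_prod; apply/prodf_neq0 => y yx.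
by rewrite !hornerE subr_eq0 eq_sym.
Qed.

(** This is the Frobenius identity rho^q = b - a Y^q. For nonzero a, composing X^q - X, the product
    of all X - x, with [rho] gives factors -a (Y - (b - x)/a); here (-a)^q = -a, and x -> (b - x)/a
    permutes F. *)
Lemma genPoly_comp_affine (a b : F) (rho := b%:P - a *: 'X : {poly F}) :
  rho - rho ^+ #|F| = a *: ('X^#|F| - 'X).
Proof.
have comp : ('X^#|F| - 'X) \Po rho = rho ^+ #|F| - rho.
  by rewrite comp_polyB comp_Xn_poly comp_polyX.
have -> : rho - rho ^+ #|F| = - (('X^#|F| - 'X) \Po rho).
  by rewrite comp opprB.
have [a0|a0] := eqVneq a 0.
  rewrite comp /rho a0 !scale0r subr0 -rmorphXn /= expf_card subrr oppr0 //.
have XsubC_comp x : ('X - x%:P) \Po rho = (- a) *: ('X - ((b - x) / a)%:P).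
  have e : - a * ((b - x) / a) = x - b by field.
  rewrite comp_polyB comp_polyX comp_polyC /rho scalerBr -!mul_polyC -polyCM e.
  rewrite polyCB polyCN; ring.
rewrite finField_genPoly rmorph_prod /= (eq_bigr _ (fun x _ => XsubC_comp x)).
rewrite scaler_prod prodr_const cardT -cardE expf_card scaleNr opprK; congr (_ *: _).
have inj : injective (fun x => (b - x) / a).
  by move=> x y /(mulIf (invr_neq0 a0)) /addrI /oppr_inj.
by rewrite [RHS](reindex_inj inj).
Qed.

(** * Dual lines and the Rédei polynomial *)

Definition slope_root u : {poly F} := u.2%:P - u.1 *: 'X.
(** The point u = (a, b) is dually the line X + aY - b = 0, with root [slope_root u] in X. Its value
    at Y = c is the intercept of the line of slope c through u, so [intercept c] is injective on a
    set when no line of slope c meets the set twice. *)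
Definition intercept c u : F := u.2 - u.1 * c.

Lemma horner_slope_root c u : (slope_root u).[c] = intercept c u.
Proof. by rewrite /slope_root !hornerE. Qed.

Lemma slope_root_inj : injective slope_root.
Proof.
move=> [a b] [a' b'] /polyP E.
have := E 0%N; have := E 1%N.
rewrite !coefB !coefC !coefZ !coefX /= !mulr0 !mulr1 !sub0r !subr0.
by move=> /oppr_inj -> ->.
Qed.

Lemma intercept_eq c u v : u.1 != v.1 ->
  (intercept c u == intercept c v) = (c == (u.2 - v.2) / (u.1 - v.1)).
Proof.
rewrite -subr_eq0 => uv.
rewrite -[RHS](inj_eq (mulIf uv)) divfK // -[LHS]subr_eq0 -[RHS]subr_eq0.
by rewrite -[LHS]oppr_eq0 /intercept; congr (_ == 0); ring.
Qed.

Definition redei_poly U : {poly {poly F}} :=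
  \prod_(u <- enum U) ('X - (slope_root u)%:P).

Lemma redei_poly_monic U : redei_poly U \is monic.
Proof. exact: monic_prod_XsubC. Qed.

Lemma size_redei_poly U : size (redei_poly U) = #|U|.+1.
Proof. by rewrite size_prod_XsubC -cardE. Qed.

Lemma tdeg_redei_poly U : tdeg_le #|U| (redei_poly U).
Proof.
rewrite cardE; apply: tdeg_le_prod_XsubC => u.
rewrite (leq_trans (size_polyD _ _)) // size_polyN geq_max.
rewrite (leq_trans (size_polyC_leq1 _)) //=.
by rewrite (leq_trans (size_scale_leq _ _)) // size_polyX.
Qed.

Lemma horner_redei_poly U u : u \in U -> (redei_poly U).[slope_root u] = 0.
Proof.
move=> uU; rewrite /redei_poly big_enum (bigD1 u) //=.
by rewrite hornerM hornerXsubC subrr mul0r.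
Qed.

Lemma eval_redei_poly c U :
  eval_inner c (redei_poly U) = \prod_(u <- enum U) ('X - (intercept c u)%:P).
Proof.
rewrite eval_inner_prod_XsubC.
by apply: eq_bigr => u _; rewrite horner_slope_root.
Qed.

(** Divide X^q by H, the Rédei polynomial of U, with remainder r, and put C = X - r. For c in N the
    roots of H(X,c) are distinct elements of F, so H(X,c) divides X^q - X and hence C(X,c), which
    has degree less than |U| and must vanish. *)
Lemma redei_cofactor U N : (1 < #|U| <= #|F|)%N ->
    {in N, forall c, {in U &, injective (intercept c)}} ->
  exists f C : {poly {poly F}},
    [/\ f * redei_poly U = 'X^#|F| - 'X + C, tdeg_le #|F| C
      & {in N, forall c, eval_inner c C = 0}].
Proof.
move=> /andP[U2 Uq] Ninj.
have [f [r [Xq rU fdeg rdeg]]] := tdeg_le_divE Uq (redei_poly_monic U)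
  (size_redei_poly U) (tdeg_redei_poly U) (@tdeg_le_Xn F #|F|).
have q0 : (0 < #|F|)%N by apply: leq_trans Uq; apply: ltnW.
exists f, ('X - r); split.
- by rewrite Xq; ring.
- apply: tdeg_leB => //; apply: (@tdeg_leW _ 1) => //.
  by rewrite -(expr1 'X); apply: tdeg_le_Xn.
move=> c cN; rewrite eval_innerB eval_innerX.
have dvd : eval_inner c (redei_poly U) %| 'X - eval_inner c r.
  have -> : 'X - eval_inner c r =
      eval_inner c f * eval_inner c (redei_poly U) - ('X^#|F| - 'X).
    rewrite -eval_innerM.
    have -> : f * redei_poly U = 'X^#|F| - r by rewrite Xq addrK.
    by rewrite eval_innerB eval_innerXn; ring.
  rewrite dvdp_sub ?dvdp_mull // eval_redei_poly.
  rewrite -(big_map (intercept c) xpredT (fun x => 'X - x%:P)).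
  apply: uniq_roots_dvdp.
    by apply/allP => x _; rewrite rootE hornerD hornerN hornerXn hornerX expf_card subrr.
  rewrite uniq_rootsE map_inj_in_uniq ?enum_uniq // => u v.
  by rewrite !mem_enum; apply: Ninj.
apply: contraTeq isT => C0.
have := dvdp_leq C0 dvd; have [_ ->] := eval_inner_monic c (redei_poly_monic U).
rewrite size_redei_poly leqNgt ltnS (leq_trans (size_polyD _ _)) //.
rewrite size_polyX size_polyN geq_max U2 /=.
exact: leq_trans (size_eval_inner _ _) rU.
Qed.

Lemma imset_intercept_dvd c U :
  \prod_(x <- enum (intercept c @: U)) ('X - x%:P) %| eval_inner c (redei_poly U).
Proof.
apply: uniq_roots_dvdp; last by rewrite uniq_rootsE enum_uniq.
apply/allP => _ /[!mem_enum] /imsetP[u uU ->].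
by rewrite rootE -horner_slope_root horner_eval_inner horner_redei_poly ?horner0.
Qed.

Lemma vanishing_split N (prodC := fun A : {set F} => \prod_(c <- enum A) ('X - c%:P) : {poly F}) :
  prodC N * prodC (~: N) = 'X^#|F| - 'X.
Proof.
rewrite finField_genPoly /prodC !big_enum [RHS](bigID (mem N)) /=; congr (_ * _).
by apply: eq_bigl => x; rewrite inE.
Qed.

(** Write C = [prodC N] G and let R be G made monic in X. Division gives H = W R + S with S =
    [prodC (~: N)] L, and V is -gamma L, where gamma is the leading coefficient of G. *)
Lemma foliation U N (r := (#|F| - #|N|)%N) : (1 < #|U| <= #|F|)%N ->
    {in N, forall c, {in U &, injective (intercept c)}} ->
    (forall c, c \notin N -> r <= #|intercept c @: U|)%N ->
    (exists2 c, c \notin N & ~ {in U &, injective (intercept c)}) ->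
  exists W V : {poly {poly F}},
    [/\ W \is monic, size W = (#|U| - r).+1, (size V <= (#|U| - r).+1)%N
      & {in U, forall u, V.[slope_root u] = u.1 *: W.[slope_root u]}].
Proof.
move=> Ucard Ninj Dimg [c0 c0N c0inj].
set H := redei_poly U; pose prodC (A : {set F}) : {poly F} := \prod_(c <- enum A) ('X - c%:P).
have rE : r = #|~: N| by rewrite /r -(cardsC N) addKn.
have Nq : (#|F| - r)%N = #|N| by rewrite /r subKn // max_card.
have rq : (r <= #|F|)%N by rewrite leq_subr.
have rU : (r <= #|U|)%N := leq_trans (Dimg _ c0N) (leq_imset_card _ _).
have [f [C [fH Cdeg CN]]] := redei_cofactor Ucard Ninj.
have [G CG Gdeg] : exists2 G, C = prodC N *: G & tdeg_le r G.
  rewrite /r cardE; apply: eval_inner_eq0_divE => //; first exact: enum_uniq.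
  by move=> c /[!mem_enum]; apply: CN.
(* At an intercept x both H(X,c) and X^q - X vanish, hence so does [prodC N] G, whose first factor
   is nonzero at c. *)
have Groot c x : c \notin N -> x \in intercept c @: U -> root (eval_inner c G) x.
  move=> cN /imsetP[u uU ->].
  have prodN0 : (prodC N).[c] != 0.
    by rewrite -rootE root_prod_XsubC mem_enum.
  have : eval_inner c ('X^#|F| - 'X + C) = eval_inner c f * eval_inner c H.
    by rewrite -eval_innerM fH.
  rewrite CG eval_innerD eval_innerB eval_innerXn eval_innerX eval_innerZ.
  move/(congr1 (horner^~ (intercept c u))).
  rewrite hornerD hornerZ hornerM -{4}horner_slope_root horner_eval_inner.
  rewrite horner_redei_poly // horner0 mulr0 hornerD hornerN hornerXn hornerX expf_card.
  by rewrite subrr add0r => /eqP; rewrite mulf_eq0 (negPf prodN0).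
have Gsize : (size G <= r.+1)%N := tdeg_le_size Gdeg.
set gamma := (G`_r)`_0.
have gammaE : G`_r = gamma%:P.
  by apply: size1_polyC; have := Gdeg r; rewrite subSnn.
(* If G(X,c0) were zero, H(X,c0) would divide X^q - X, which has no repeated root, whereas two
   points of U share an intercept at c0. Being nonzero with at least r roots, G(X,c0) has degree
   exactly r. *)
have gamma0 : gamma != 0.
  have G0 : eval_inner c0 G != 0.
    apply: contra_not_neq c0inj => G0.
    have dvd : eval_inner c0 H %| 'X^#|F| - 'X.
      apply/dvdpP; exists (eval_inner c0 f); rewrite -eval_innerM fH CG.
      by rewrite eval_innerD eval_innerB eval_innerXn eval_innerX eval_innerZ G0 scaler0 addr0.
    apply/dinjectiveP; apply: contraT => /dinjectivePn[u uU [v]].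
    rewrite inE /= => /andP[vu vU] uv.
    have := sqr_XsubC_ndvd_genPoly (intercept c0 u).
    rewrite (dvdp_trans _ dvd) // eval_redei_poly big_enum (bigD1 u) //=.
    rewrite (bigD1 v) /=; last by rewrite vU vu.
    by rewrite -uv mulrA -expr2 dvdp_mulr.
  have rG : (r < size (eval_inner c0 G))%N.
    apply: leq_ltn_trans (Dimg _ c0N) _; rewrite cardE.
    apply: max_poly_roots => //; last exact: enum_uniq.
    by apply/allP => x /[!mem_enum]; apply: Groot.
  have sG : size (eval_inner c0 G) = r.+1.
    by apply/eqP; rewrite eqn_leq rG (leq_trans (size_eval_inner _ _)).
  have : lead_coef (eval_inner c0 G) != 0 by rewrite lead_coef_eq0.
  by rewrite lead_coefE sG /= coef_eval_inner gammaE hornerC.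
have sizeG : size G = r.+1.
  apply/eqP; rewrite eqn_leq Gsize /= ltnNge; apply: contraNN gamma0 => /leq_sizeP/(_ r (leqnn r)).
  by rewrite gammaE => /eqP; rewrite polyC_eq0.
pose R : {poly {poly F}} := gamma^-1%:P *: G.
have GR : G = gamma%:P *: R by rewrite scalerA -polyCM divff // scale1r.
have sizeR : size R = r.+1.
  by rewrite size_scale // polyC_eq0 invr_eq0.
have Rmon : R \is monic.
  by apply/monicP; rewrite lead_coefE sizeR coefZ gammaE -polyCM mulVf.
have Rdeg : tdeg_le r R by apply: tdeg_leZ.
have [W [S [HE Sr Wdeg Sdeg]]] := tdeg_le_divE rU Rmon sizeR Rdeg (tdeg_redei_poly U).
have [Wmon Wsize] := monic_divE rU (redei_poly_monic U) (size_redei_poly U) Rmon sizeR HE Sr.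
(* R(X,c) is monic of degree r and vanishes at no fewer than r intercepts, so it is the product of
   the X - x over them. It therefore divides H(X,c) and S(X,c), and S has X-degree below r. *)
have SD c : c \notin N -> eval_inner c S = 0.
  move=> cN; set I := intercept c @: U.
  have [cRmon cRsize] := eval_inner_monic c Rmon.
  have PR : \prod_(x <- enum I) ('X - x%:P) %| eval_inner c R.
    apply: uniq_roots_dvdp; last by rewrite uniq_rootsE enum_uniq.
    apply/allP => x /[!mem_enum] xI; rewrite eval_innerZ rootE hornerZ.
    by have /rootP -> := Groot c x cN xI; rewrite mulr0.
  have RP : \prod_(x <- enum I) ('X - x%:P) %= eval_inner c R.
    rewrite -dvdp_size_eqp // eqn_leq dvdp_leq ?monic_neq0 //=.
    by rewrite cRsize sizeR size_prod_XsubC -cardE ltnS Dimg.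
  have RS : eval_inner c R %| eval_inner c S.
    have -> : eval_inner c S = eval_inner c H - eval_inner c W * eval_inner c R.
      by rewrite /H HE eval_innerD eval_innerM addrC addKr.
    by rewrite dvdp_sub ?dvdp_mull // -(eqp_dvdl _ RP) imset_intercept_dvd.
  apply: contraTeq RS => S0; rewrite gtNdvdp // cRsize sizeR ltnS.
  exact: leq_trans (size_eval_inner _ _) Sr.
have [L SL Ldeg] : exists2 L, S = prodC (~: N) *: L & tdeg_le (#|U| - r) L.
  have -> : r = size (enum (~: N)) by rewrite rE cardE.
  apply: eval_inner_eq0_divE => //; first exact: enum_uniq.
  by move=> c /[!mem_enum] /[!inE]; apply: SD.
exists W, (- gamma%:P *: L); split=> //.
  by rewrite (leq_trans (size_scale_leq _ _)) // tdeg_le_size.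
move=> u uU; set rho := slope_root u.
have N0 A : prodC A != 0 by rewrite monic_neq0 // monic_prod_XsubC.
have HW : W.[rho] * R.[rho] + prodC (~: N) * L.[rho] = 0.
  by rewrite -(hornerZ (prodC (~: N))) -SL -hornerM -hornerD -HE (horner_redei_poly uU).
(* Putting X = rho in f H = X^q - X + C gives rho - rho^q = C(rho). The left side is a (Y^q - Y),
   and [prodC N] cancels. Multiplying by W(rho) and using H(rho) = 0 then yields V = aW. *)
have aM : u.1 *: prodC (~: N) = gamma%:P * R.[rho].
  apply: (mulfI (N0 N)); rewrite -scalerAr vanishing_split.
  rewrite -[LHS](genPoly_comp_affine u.1 u.2) -/(slope_root u) -/rho -hornerZ -GR -hornerZ -CG.
  have := congr1 (horner^~ rho) fH; rewrite hornerM (horner_redei_poly uU) mulr0.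
  rewrite hornerD hornerD hornerN hornerXn hornerX => /esym/eqP.
  by rewrite addrC addr_eq0 opprB => /eqP.
suff : prodC (~: N) * (- gamma%:P *: L).[rho] = prodC (~: N) * (u.1 *: W.[rho]).
  by move/(mulfI (N0 _)).
rewrite -scalerAr scalerAl aM hornerZ mulrCA.
have -> : prodC (~: N) * L.[rho] = - (W.[rho] * R.[rho]).
  by apply/eqP; rewrite -addr_eq0 addrC HW.
ring.
Qed.

(** * Comparison of two foliations *)

Lemma eval_foliation (K : fieldType) (iota : {rmorphism F -> K}) (y : K) u
    (phi := horner_eval y \o map_poly iota : {rmorphism {poly F} -> K})
    (W V : {poly {poly F}}) (x := iota u.2 - iota u.1 * y) :
  V.[slope_root u] = u.1 *: W.[slope_root u] ->
  (map_poly phi V).[x] = iota u.1 * (map_poly phi W).[x].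
Proof.
have <- : phi (slope_root u) = x.
  rewrite /phi /= /horner_eval /slope_root rmorphB /= map_polyC map_polyZ.
  by rewrite map_polyX !hornerE /x; reflexivity.
move=> VW; rewrite !horner_map VW -mul_polyC rmorphM /=; congr (_ * _).
by rewrite /horner_eval map_polyC hornerC.
Qed.

(** In homogeneous dual coordinates this exchanges Y and Z: X + aY - bZ = 0 becomes X - bY + aZ = 0.
    Slopes are inverted, and slope 0 is exchanged with the vertical direction. *)
Definition swap u : F * F := (- u.2, - u.1).

Lemma swap_inj : injective swap.
Proof. by move=> [a b] [a' b'] [/oppr_inj-> /oppr_inj->]. Qed.

Lemma intercept_swap c u : c != 0 -> intercept c^-1 (swap u) = c^-1 * intercept c u.
Proof. by move=> c0; rewrite /intercept /=; field. Qed.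

(** The slope of the line joining u and v works, since that line meets U twice. *)
Lemma noninjective_direction U N u v :
    {in N, forall c, {in U &, injective (intercept c)}} ->
    u \in U -> v \in U -> u.1 != v.1 ->
  exists2 c, c \notin N & ~ {in U &, injective (intercept c)}.
Proof.
move=> Ninj uU vU uv.
have noninj : ~ {in U &, injective (intercept ((u.2 - v.2) / (u.1 - v.1)))}.
  move=> inj; case/eqP: (uv); rewrite (inj u v) //.
  by apply/eqP; rewrite intercept_eq.
exists ((u.2 - v.2) / (u.1 - v.1)) => //.
by apply/negP => /Ninj.
Qed.

(** The new slope 0 is the old vertical direction, whose intercepts are the abscissas up to sign;
    other slopes are inverted. As 0 is not in N, the default value 0^-1 = 0 never enters [N']. *)
Lemma swap_intercepts U N (r := (#|F| - #|N|)%N)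
    (U' := swap @: U) (N' := [set c^-1 | c in N]) : 0 \notin N ->
    {in N, forall c, {in U &, injective (intercept c)}} ->
    (forall c, c \notin N -> r <= #|intercept c @: U|)%N ->
    (r <= #|[set u.1 | u in U]|)%N ->
  {in N', forall c, {in U' &, injective (intercept c)}} /\
  (forall c, c \notin N' -> r <= #|intercept c @: U'|)%N.
Proof.
move=> N0 Ninj Dimg Iimg; split.
  move=> _ /imsetP[c cN ->] _ _ /imsetP[u uU ->] /imsetP[v vU ->].
  have c0 : c != 0 by apply: contraNneq N0 => <-.
  rewrite !intercept_swap // => /(mulfI (invr_neq0 c0)) E.
  by rewrite (Ninj c cN u v).
move=> c; rewrite /U' -imset_comp; have [-> _|c0 cN] := eqVneq c 0.
  have -> : (intercept 0 \o swap) @: U = -%R @: [set u.1 | u in U].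
    by rewrite -imset_comp; apply: eq_imset => u; rewrite /= /intercept mulr0 subr0.
  by rewrite card_imset //; apply: oppr_inj.
have -> : (intercept c \o swap) @: U = *%R c @: (intercept c^-1 @: U).
  rewrite -imset_comp; apply: eq_imset => u /=.
  by rewrite -{1}(invrK c) intercept_swap ?invr_eq0 // invrK.
rewrite card_imset; last exact: mulfI.
apply: Dimg; apply: contra cN => cN; apply/imsetP.
by exists c^-1; rewrite ?invrK.
Qed.

(* [W'] and [V'] are transported to the chart of [W] and [V] by [Y -> 1/Y];
   the form [Psi] of degree [2 d + 1] then vanishes on every line of [U]. *)
Lemma foliations_bound (K : fieldType) (iota : {rmorphism F -> K}) (y : K)
    (root_of := fun u => iota u.2 - iota u.1 * y) U d (W V W' V' : {poly {poly F}}) :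
    y != 0 -> {in U &, injective root_of} ->
    W \is monic -> size W = d.+1 -> (size V <= d.+1)%N ->
    {in U, forall u, V.[slope_root u] = u.1 *: W.[slope_root u]} ->
    W' \is monic -> size W' = d.+1 -> (size V' <= d.+1)%N ->
    {in swap @: U, forall u, V'.[slope_root u] = u.1 *: W'.[slope_root u]} ->
  (#|U| <= d.*2.+1)%N.
Proof.
move=> y0 root_inj Wmon Wsize Vsize VW W'mon W'size V'size VW'.
pose phi z : {rmorphism {poly F} -> K} := horner_eval z \o map_poly iota.
pose P1 := map_poly (phi y) W; pose Q1 := map_poly (phi y) V.
(* The point (X : y : 1) of the dual plane has coordinates (X/y, 1/y) in the other chart. *)
pose P2 := map_poly (phi y^-1) W' \Po (y^-1 *: 'X).
pose Q2 := map_poly (phi y^-1) V' \Po (y^-1 *: 'X).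
have scale2 : size (y^-1 *: 'X : {poly K}) = 2.
  by rewrite size_scale ?invr_eq0 // size_polyX.
have P1mon : P1 \is monic by apply: monic_map.
have P1size : size P1 = d.+1.
  by rewrite size_map_poly_id0 // (monicP Wmon) rmorph1 oner_neq0.
have P2size : size P2 = d.+1.
  by rewrite size_comp_poly2 // size_map_poly_id0 // (monicP W'mon) rmorph1 oner_neq0.
have Q1size : (size Q1 <= d.+1)%N by apply: leq_trans (size_poly _ _) _.
have Q2size : (size Q2 <= d.+1)%N.
  by rewrite size_comp_poly2 //; apply: leq_trans (size_poly _ _) _.
have P20 : P2 != 0 by rewrite -size_poly_gt0 P2size.
(* At X = b - a y one has Q1 = a P1 and Q2 = -b P2, so Psi = P1 P2 (X + a y - b) = 0. The first
   summand has degree 2d + 1 and the others at most 2d. *)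
pose Psi := P1 * P2 * 'X + (P1 * Q2 + y *: (Q1 * P2)).
have sizePsi : size Psi = d.+1.*2.
  have s1 : size (P1 * P2 * 'X) = d.+1.*2.
    rewrite size_mulX ?mulf_neq0 ?(monic_neq0 P1mon) // size_monicM //.
    by rewrite P1size P2size; lia.
  have s2 : (size (P1 * Q2)%R < d.+1.*2)%N.
    by apply: leq_ltn_trans (size_polyMleq _ _) _; rewrite P1size; move: (size Q2) Q2size => s; lia.
  have s3 : (size (y *: (Q1 * P2))%R < d.+1.*2)%N.
    apply: leq_ltn_trans (size_scale_leq _ _) _.
    by apply: leq_ltn_trans (size_polyMleq _ _) _; rewrite P2size; move: (size Q1) Q1size => s; lia.
  by rewrite size_polyDl s1 // (leq_ltn_trans (size_polyD _ _)) // gtn_max s2 s3.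
have Psi_root u : u \in U -> root Psi (root_of u).
  move=> uU; rewrite rootE /Psi !(hornerD, hornerM, hornerZ, hornerX) !horner_comp.
  rewrite !hornerZ !hornerX (eval_foliation iota y (VW u uU)).
  have -> : y^-1 * root_of u = iota (swap u).2 - iota (swap u).1 * y^-1.
    by rewrite /root_of /= !rmorphN; field.
  rewrite (eval_foliation iota y^-1 (VW' _ (imset_f swap uU))) /root_of /= rmorphN.
  by apply/eqP; ring.
have : (size [seq root_of u | u <- enum U] < size Psi)%N.
  apply: max_poly_roots; first by rewrite -size_poly_gt0 sizePsi.
    by apply/allP => _ /mapP[u uU ->]; apply: Psi_root; rewrite -mem_enum.
  by rewrite map_inj_in_uniq ?enum_uniq // => u v; rewrite !mem_enum; apply: root_inj.
by rewrite size_map -cardE sizePsi doubleS ltnS.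
Qed.

(** The last two hypotheses and 0 outside N make both the slope 0 and the vertical direction
    available as the distinguished one. With d = |U| - r, the bound |U| <= 2d + 1 reads 2r <= |U| +
    1. *)
Lemma intercept_bound U N (r := (#|F| - #|N|)%N) : (1 < r)%N ->
    (#|U| <= #|F|)%N -> 0 \notin N ->
    {in N, forall c, {in U &, injective (intercept c)}} ->
    (forall c, c \notin N -> r <= #|intercept c @: U|)%N ->
    (r <= #|[set u.1 | u in U]|)%N ->
  (2 * r <= #|U|.+1)%N.
Proof.
move=> r1 Uq N0 Ninj Dimg Iimg.
have rU : (r <= #|U|)%N := leq_trans Iimg (leq_imset_card _ _).
have Ucard : (1 < #|U| <= #|F|)%N by rewrite Uq (leq_trans r1).
have [W [V [Wmon Wsize Vsize VW]]] :
    exists W V : {poly {poly F}},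
    [/\ W \is monic, size W = (#|U| - r).+1, (size V <= (#|U| - r).+1)%N
      & {in U, forall u, V.[slope_root u] = u.1 *: W.[slope_root u]}].
  apply: foliation => //.
  have /card_gt1P[_ [_ [/imsetP[u uU ->] /imsetP[v vU ->] uv]]] := leq_trans r1 Iimg.
  exact: noninjective_direction uU vU uv.
set U' := swap @: U; set N' := [set c^-1 | c in N].
have U'E : #|U'| = #|U| by rewrite card_imset //; apply: swap_inj.
have N'E : #|N'| = #|N| by rewrite card_imset //; apply: invr_inj.
have [N'inj D'img] := swap_intercepts N0 Ninj Dimg Iimg.
have [W' [V' [W'mon W'size V'size VW']]] :
    exists W V : {poly {poly F}},
    [/\ W \is monic, size W = (#|U| - r).+1, (size V <= (#|U| - r).+1)%N
      & {in U', forall u, V.[slope_root u] = u.1 *: W.[slope_root u]}].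
  rewrite -U'E /r -N'E; apply: foliation; rewrite ?U'E //.
    by rewrite N'E.
  (* At slope 0 the intercepts are the ordinates, so two points of U have distinct ordinates, which
     the swap turns into distinct abscissas. *)
  have := leq_trans r1 (Dimg 0 N0).
  move=> /card_gt1P[_ [_ [/imsetP[u uU ->] /imsetP[v vU ->]]]].
  rewrite /intercept !mulr0 !subr0 => uv.
  apply: (noninjective_direction N'inj (imset_f swap uU) (imset_f swap vU)).
  by rewrite /= (inj_eq oppr_inj).
set d := (#|U| - r)%N in Wsize Vsize W'size V'size.
(* A generic value of Y: over F(Y) with y = Y, distinct points (a, b) give distinct roots b - aY. *)
pose K := {fraction {poly F}}.
pose iota : {rmorphism F -> K} := @tofrac {poly F} \o polyC.
pose y : K := tofrac 'X.
have y0 : y != 0 by rewrite tofrac_eq0 polyX_eq0.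
pose root_of u := iota u.2 - iota u.1 * y.
have root_inj : injective root_of.
  move=> u v; have rootE w : root_of w = tofrac (slope_root w).
    by rewrite /root_of /slope_root -mul_polyC tofracB tofracM.
  by rewrite !rootE => /eqP; rewrite tofrac_eq => /eqP /slope_root_inj.
have := foliations_bound y0 (in2W root_inj) Wmon Wsize Vsize VW W'mon W'size V'size VW'.
by rewrite /d; move: rU; lia.
Qed.

End RedeiPolynomial.

(** * Incidence and coordinates in PG(2, q) *)

Section Incidence.

Variable F : finFieldType.
Implicit Types (P Q R : pg2_point F) (l m : pg2_line F) (v w : 'rV[F]_3).

Lemma dim_point P : \dim (val P) = 1%N.
Proof. exact/eqP/(valP P). Qed.

Lemma dim_line l : \dim (val l) = 2%N.
Proof. exact/eqP/(valP l). Qed.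

Lemma dimvf3 : \dim {: 'rV[F]_3} = 3%N.
Proof. by rewrite dimvf dim_matrix. Qed.

Lemma dim1_vline (U : {vspace 'rV[F]_3}) :
  (0 < \dim U)%N -> exists2 v, v != 0 & (<[v]> <= U)%VS.
Proof.
rewrite lt0n dimv_eq0 => U0; exists (vpick U); first by rewrite vpick0.
by rewrite -memvE memv_pick.
Qed.

Lemma point_vline P : exists2 v, v != 0 & val P = <[v]>%VS.
Proof.
have [|v v0 vP] := @dim1_vline (val P); first by rewrite dim_point.
by exists v => //; apply/eqP; rewrite eq_sym eqEdim vP dim_point dim_vline v0.
Qed.

Lemma vline_point v : v != 0 -> exists P, val P = <[v]>%VS.
Proof.
move=> v0; have dv : \dim <[v]> == 1%N by rewrite dim_vline v0.
by exists (exist (fun U : {vspace 'rV[F]_3} => \dim U == 1%N) _ dv).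
Qed.

Lemma sub_points_eq P Q : (val P <= val Q)%VS -> P = Q.
Proof. by move=> PQ; apply/val_inj/eqP; rewrite eqEdim PQ !dim_point. Qed.

Lemma dim_join P Q : P != Q -> \dim (val P + val Q) = 2%N.
Proof.
move=> PQ; have := dimv_sum_cap (val P) (val Q); rewrite !dim_point.
suff -> : \dim (val P :&: val Q) = 0%N by rewrite addn0.
apply/eqP; rewrite -leqn0 leqNgt; apply: contra PQ => cap.
have capP : (val P :&: val Q == val P)%VS by rewrite eqEdim capvSl dim_point.
by apply/eqP/sub_points_eq; rewrite -(eqP capP) capvSr.
Qed.

Lemma join_line P Q : P != Q ->
  exists l, P \in points_on l /\ Q \in points_on l.
Proof.
move/dim_join => /eqP PQ; exists (exist (fun U : {vspace 'rV[F]_3} => \dim U == 2%N) _ PQ).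
by rewrite !inE /= addvSl addvSr.
Qed.

Lemma line_eq P Q l m : P != Q -> P \in points_on l -> Q \in points_on l ->
  P \in points_on m -> Q \in points_on m -> l = m.
Proof.
rewrite !inE => PQ Pl Ql Pm Qm.
have join (n : pg2_line F) : (val P <= val n)%VS -> (val Q <= val n)%VS -> (val P + val Q)%VS = val n.
  by move=> Pn Qn; apply/eqP; rewrite eqEdim subv_add Pn Qn dim_join // dim_line.
by apply: val_inj; rewrite -(join l) // -(join m).
Qed.

Lemma meet_point l m : exists P, P \in points_on l /\ P \in points_on m.
Proof.
have cap : (0 < \dim (val l :&: val m))%N.
  have := dimv_sum_cap (val l) (val m); rewrite !dim_line.
  by have := dimvS (subvf (val l + val m)%VS); rewrite dimvf3; lia.
have [v v0 vlm] := dim1_vline cap; have [P vP] := vline_point v0.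
by exists P; rewrite !inE vP; apply/andP; rewrite -subv_cap.
Qed.

Lemma tangentP (S : {set pg2_point F}) P l :
  reflect [/\ P \in S, P \in points_on l
            & forall Q, Q \in S -> Q \in points_on l -> Q = P]
          (l \in tangents S P).
Proof.
rewrite [l \in _]inE; apply: (iffP eqP) => [lS|[PS Pl uniqP]].
  have /setIP[Pl PS] : P \in points_on l :&: S by rewrite lS set11.
  by split=> // Q QS Ql; apply/set1P; rewrite -lS inE Ql.
apply/setP => Q; rewrite in_setI in_set1.
apply/andP/eqP => [[Ql QS]|->]; [exact: uniqP|by []].
Qed.

(** * Homogeneous coordinates with respect to a frame *)

Definition comb3 (u v w : 'rV[F]_3) (a b c : F) := a *: u + b *: v + c *: w.

Definition independent3 (u v w : 'rV[F]_3) : Prop :=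
  forall a b c : F, comb3 u v w a b c = 0 -> [/\ a = 0, b = 0 & c = 0].

Lemma comb3D u v w a b c a' b' c' :
  comb3 u v w a b c + comb3 u v w a' b' c' = comb3 u v w (a + a') (b + b') (c + c').
Proof. by rewrite /comb3 !scalerDl addrACA [X in X + _]addrACA. Qed.

Lemma comb3Z u v w k a b c :
  k *: comb3 u v w a b c = comb3 u v w (k * a) (k * b) (k * c).
Proof. by rewrite /comb3 !scalerDr !scalerA. Qed.

Lemma comb3_100 u v w : comb3 u v w 1 0 0 = u.
Proof. by rewrite /comb3 scale1r !scale0r !addr0. Qed.

Lemma comb3_010 u v w : comb3 u v w 0 1 0 = v.
Proof. by rewrite /comb3 scale1r !scale0r add0r addr0. Qed.

Lemma comb3_001 u v w : comb3 u v w 0 0 1 = w.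
Proof. by rewrite /comb3 scale1r !scale0r !add0r. Qed.

(* Junk value [P0] on the zero vector. *)
Definition point_of P0 v : pg2_point F := insubd P0 <[v]>%VS.

Lemma val_point_of P0 v : v != 0 -> val (point_of P0 v) = <[v]>%VS.
Proof. by move=> v0; rewrite val_insubd dim_vline v0. Qed.

Lemma point_of_scale P0 (a : F) v : a != 0 -> point_of P0 (a *: v) = point_of P0 v.
Proof.
move=> a0; rewrite /point_of; congr insubd; apply/eqP.
rewrite eqEsubv -!memvE memvZ ?memv_line //=.
by apply/vlineP; exists a^-1; rewrite scalerA mulVf // scale1r.
Qed.

Lemma mem_point_of P0 v l : v != 0 -> (point_of P0 v \in points_on l) = (v \in val l).
Proof. by move=> v0; rewrite inE val_point_of // memvE. Qed.

Lemma point_of_surj P0 P : exists2 v, v != 0 & P = point_of P0 v.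
Proof.
have [v v0 vP] := point_vline P; exists v => //.
by apply: val_inj; rewrite val_point_of.
Qed.

Section Frame.

Variables (P0 : pg2_point F) (u v w : 'rV[F]_3).
Hypothesis ind : independent3 u v w.

Let cmb := comb3 u v w.
Let pt a b c := point_of P0 (cmb a b c).

Lemma comb3_inj a b c a' b' c' : cmb a b c = cmb a' b' c' ->
  [/\ a = a', b = b' & c = c'].
Proof.
move=> E; have : cmb (a - a') (b - b') (c - c') = 0.
  rewrite /cmb -comb3D -/cmb E comb3D !subrr /comb3 !scale0r !addr0 //.
by move=> /ind[/subr0_eq-> /subr0_eq-> /subr0_eq->].
Qed.

Lemma comb3_neq0 a b c : [|| a != 0, b != 0 | c != 0] -> cmb a b c != 0.
Proof. by apply: contraTneq => /ind[-> -> ->]; rewrite eqxx. Qed.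

Lemma comb3_surj x : exists a b c : F, x = cmb a b c.
Proof.
have fr : free [:: u; v; w].
  apply/(@freeP _ _ _ [tuple u; v; w]) => k.
  rewrite !big_ord_recl big_ord0 addr0 addrA => /ind[k0 k1 k2] i.
  case: i => [[|[|[|//]]] i3] /=.
  - by rewrite -k0; congr k; apply: val_inj.
  - by rewrite -k1; congr k; apply: val_inj.
  - by rewrite -k2; congr k; apply: val_inj.
have : x \in <<[:: u; v; w]>>%VS.
  have /eqP -> : <<[:: u; v; w]>>%VS == fullv.
    by rewrite eqEdim subvf dimvf3 (eqP fr).
  exact: memvf.
rewrite !span_cons span_nil addv0.
case/memv_addP => _ /vlineP[a ->] [_ /memv_addP[_ /vlineP[b ->] [_ /vlineP[c ->] ->]] ->].
by exists a, b, c; rewrite addrA.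
Qed.

Lemma pt_scale k a b c : k != 0 -> pt (k * a) (k * b) (k * c) = pt a b c.
Proof. by move=> k0; rewrite /pt /cmb -comb3Z point_of_scale. Qed.

Lemma pt_eq a b c a' b' c' : [|| a != 0, b != 0 | c != 0] ->
    [|| a' != 0, b' != 0 | c' != 0] -> pt a b c = pt a' b' c' ->
  exists k, [/\ a = k * a', b = k * b' & c = k * c'].
Proof.
move=> n n' /(congr1 val); rewrite !val_point_of ?comb3_neq0 // => E.
have /vlineP[k] : cmb a b c \in <[cmb a' b' c']>%VS by rewrite -E memv_line.
by rewrite /cmb comb3Z => /comb3_inj; exists k.
Qed.

Lemma mem_line_pt l a b c : [|| a != 0, b != 0 | c != 0] ->
  (pt a b c \in points_on l) = (cmb a b c \in val l).
Proof. by move=> n; rewrite mem_point_of ?comb3_neq0. Qed.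

(** As x varies, these are the q lines through (1:0:0) other than its join with (0:1:0), indexed by
    their point (0:x:1). *)
Lemma pencil_line x : exists l : pg2_line F,
  [/\ pt 1 0 0 \in points_on l, forall s, pt s x 1 \in points_on l
    & forall Q, Q \in points_on l -> Q = pt 1 0 0 \/ exists s, Q = pt s x 1].
Proof.
have n1 : [|| (1 : F) != 0, (0 : F) != 0 | (0 : F) != 0] by rewrite oner_eq0.
have nx (s : F) : [|| s != 0, x != 0 | (1 : F) != 0] by rewrite oner_eq0 !orbT.
have [|l [l1 lx]] := @join_line (pt 1 0 0) (pt 0 x 1).
  by apply/eqP => /(pt_eq n1 (nx 0))[k [/eqP]]; rewrite mulr0 oner_eq0.
have lval : val l = (<[(cmb 1 0 0)%R]> + <[(cmb 0 x 1)%R]>)%VS.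
  apply/eqP; rewrite eq_sym eqEdim subv_add -!memvE -!mem_line_pt // l1 lx /=.
  rewrite dim_line -(val_point_of P0 (comb3_neq0 n1)).
  rewrite -(val_point_of P0 (comb3_neq0 (nx 0))) dim_join //.
  by apply/eqP => /(pt_eq n1 (nx 0))[k [/eqP]]; rewrite mulr0 oner_eq0.
exists l; split=> // [s|Q].
  rewrite mem_line_pt // lval; apply/memv_addP.
  exists (cmb s 0 0); first by apply/vlineP; exists s; rewrite /cmb comb3Z mulr1 mulr0.
  by exists (cmb 0 x 1); rewrite ?memv_line // /cmb comb3D addr0 !add0r.
have [q q0 ->] := point_of_surj P0 Q; rewrite mem_point_of // lval.
case/memv_addP => _ /vlineP[a ->] [_ /vlineP[b ->] qE].
move: qE q0; rewrite /cmb !comb3Z comb3D !mulr0 !mulr1 !add0r addr0 => -> q0.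
have [b0|b0] := eqVneq b 0.
  left; have a0 : a != 0.
    by apply: contraNneq q0 => ->; rewrite b0 mul0r /comb3 !scale0r !addr0.
  by rewrite -(pt_scale 1 0 0 a0) b0 mul0r mulr1 mulr0.
right; exists (a / b); have aE : b * (a / b) = a by rewrite mulrC divfK.
by rewrite -(pt_scale (a / b) x 1 b0) mulr1 aE.
Qed.

(** Distinct x give distinct lines of the pencil, and a line with no (s:x:1) in S touches S only at
    (1:0:0). *)
Lemma pencil_tangents (S : {set pg2_point F}) : pt 1 0 0 \in S ->
  (#|[set x : F | [forall s : F, (pt s x 1)%R \notin S]]| <= #|tangents S (pt 1 0 0)%R|)%N.
Proof.
move=> gS; set X := [set x | _].
have n1 : [|| (1 : F) != 0, (0 : F) != 0 | (0 : F) != 0] by rewrite oner_eq0.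
have nx (s x : F) : [|| s != 0, x != 0 | (1 : F) != 0] by rewrite oner_eq0 !orbT.
have [L HL] := fin_all_exists pencil_line.
have Linj : injective L.
  move=> x y Lxy; have [_ Lx _] := HL x; have [_ _ Ly] := HL y.
  have := Lx 0; rewrite Lxy => /Ly[|[s]].
    by move/(pt_eq (nx 0 x) n1) => [k [_ _ /eqP]]; rewrite mulr0 oner_eq0.
  by move/(pt_eq (nx 0 x) (nx s y)) => [k [_ -> k1]]; rewrite -[k]mulr1 -k1 mul1r.
rewrite -(card_imset _ Linj); apply/subset_leq_card/subsetP => _ /imsetP[x xX ->].
have [L1 _ LQ] := HL x; apply/tangentP; split=> // Q QS /LQ[//|[s Qs]].
by move: xX; rewrite inE => /forallP/(_ s); rewrite -Qs QS.
Qed.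

End Frame.

(** * The affine chart: slopes, intercepts and the line at infinity *)

Section Coordinates.

Variables (P0 : pg2_point F) (u v w : 'rV[F]_3).
Hypothesis ind : independent3 u v w.

Let cmb := comb3 u v w.
Let pt a b c := point_of P0 (cmb a b c).

Lemma comb3_comb3 (a1 b1 c1 a2 b2 c2 a3 b3 c3 : F) a b c :
  comb3 (cmb a1 b1 c1) (cmb a2 b2 c2) (cmb a3 b3 c3) a b c =
  cmb (a * a1 + b * a2 + c * a3) (a * b1 + b * b2 + c * b3) (a * c1 + b * c2 + c * c3).
Proof. by rewrite {1}/comb3 /cmb !comb3Z !comb3D. Qed.

Lemma comb3_slope (c a b d : F) :
  comb3 (cmb 1 c 0) v w a b d = cmb a (a * c + b) d.
Proof.
rewrite -[in LHS](comb3_010 u v w) -[X in comb3 _ _ X](comb3_001 u v w) comb3_comb3.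
by rewrite !mulr0 !mulr1 !addr0 !add0r.
Qed.

Lemma comb3_swap (a b c : F) : comb3 v u w a b c = cmb b a c.
Proof. by rewrite /cmb /comb3 [X in X + _ = _]addrC. Qed.

Lemma comb3_rot (a b c : F) : comb3 v w u a b c = cmb c a b.
Proof. by rewrite /cmb /comb3 addrC addrA. Qed.

(** With (1:c:0) as first frame vector, the pencil at (1:0:0) becomes the lines of slope c: (s:x:1)
    is the affine point (s, sc + x), of intercept x. *)
Lemma independent3_slope c : independent3 (cmb 1 c 0) v w.
Proof.
move=> a b d; rewrite comb3_slope => /ind[-> ].
by rewrite mul0r add0r.
Qed.

Lemma independent3_swap : independent3 v u w.
Proof. by move=> a b c; rewrite comb3_swap => /ind[-> -> ->]. Qed.

Lemma independent3_rot : independent3 v w u.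
Proof. by move=> a b c; rewrite comb3_rot => /ind[-> -> ->]. Qed.

Definition affine_pt (z : F * F) := pt z.1 z.2 1.

Lemma affine_pt_inj : injective affine_pt.
Proof.
have n1 (z : F * F) : [|| z.1 != 0, z.2 != 0 | (1 : F) != 0] by rewrite oner_eq0 !orbT.
move=> z z' /(pt_eq ind (n1 z) (n1 z'))[k]; rewrite mulr1 => -[z1 z2 k1].
by case: z z' z1 z2 => [a b] [a' b'] /=; rewrite -k1 !mul1r => -> ->.
Qed.

Lemma slope_pt_inj : injective (fun c => pt 1 c 0).
Proof.
have n1 (c : F) : [|| (1 : F) != 0, c != 0 | (0 : F) != 0] by rewrite oner_eq0.
by move=> c c' /(pt_eq ind (n1 c) (n1 c'))[k]; rewrite mulr1 => -[<- -> _]; rewrite mul1r.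
Qed.

Lemma slope_line c x : exists l : pg2_line F,
  pt 1 c 0 \in points_on l /\
  forall z, intercept c z = x -> affine_pt z \in points_on l.
Proof.
have [l [l1 lx _]] := pencil_line P0 (@independent3_slope c) x.
exists l; rewrite /affine_pt /pt; split.
  by rewrite comb3_slope mul1r addr0 in l1.
move=> z zx; have := lx z.1; rewrite comb3_slope -zx.
by rewrite /intercept addrC subrK.
Qed.

Lemma slope_tangents (S : {set pg2_point F}) c
    (U := [set z | affine_pt z \in S]) : pt 1 c 0 \in S ->
  (#|~: (intercept c @: U)| <= #|tangents S (pt 1 c 0)%R|)%N.
Proof.
have := pencil_tangents (P0 := P0) (@independent3_slope c) (S := S).
rewrite comb3_slope mul1r addr0 => tan /tan; apply: leq_trans.
apply/subset_leq_card/subsetP => x; rewrite !inE => xU.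
apply/forallP => s; rewrite comb3_slope; apply: contra xU => zS.
by apply/imsetP; exists (s, s * c + x); rewrite ?inE // /intercept /= addrC addKr.
Qed.

Lemma vertical_tangents (S : {set pg2_point F})
    (U := [set z | affine_pt z \in S]) : pt 0 1 0 \in S ->
  (#|~: [set z.1 | z in U]| <= #|tangents S (pt 0 1 0)%R|)%N.
Proof.
have := pencil_tangents (P0 := P0) independent3_swap (S := S).
rewrite comb3_swap => tan /tan; apply: leq_trans.
apply/subset_leq_card/subsetP => x; rewrite !inE => xU.
apply/forallP => s; rewrite comb3_swap; apply: contra xU => zS.
by apply/imsetP; exists (x, s); rewrite ?inE.
Qed.

Section LineAtInfinity.

Variable l : pg2_line F.
Hypotheses (l1 : pt 1 0 0 \in points_on l) (l2 : pt 0 1 0 \in points_on l).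

Lemma points_at_infinity :
  points_on l = pt 0 1 0 |: [set pt 1 c 0 | c in F].
Proof.
have n1 : [|| (1 : F) != 0, (0 : F) != 0 | (0 : F) != 0] by rewrite oner_eq0.
have n2 : [|| (0 : F) != 0, (1 : F) != 0 | (0 : F) != 0] by rewrite oner_eq0 !orbT.
(* In the frame v, w, u the pencil is centred at (0:1:0), and its member x = 0 consists of that
   point and all (1:s:0). *)
have [m [m1 ms mQ]] := pencil_line P0 independent3_rot 0.
have -> : l = m.
  apply: (@line_eq (pt 1 0 0) (pt 0 1 0)) => //.
  - by apply/eqP => /(pt_eq ind n1 n2)[k [/eqP]]; rewrite mulr0 oner_eq0.
  - by have := ms 0; rewrite comb3_rot.
  - by have := m1; rewrite comb3_rot.
apply/setP => Q; rewrite !inE; apply/idP/idP => [Qm|].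
  have := mQ Q; rewrite inE => /(_ Qm); rewrite comb3_rot => -[->|[s ->]].
    by rewrite eqxx.
  by apply/orP; right; rewrite comb3_rot; apply/imsetP; exists s.
case/predU1P => [->|/imsetP[s _ ->]].
  by have := m1; rewrite comb3_rot inE.
by have := ms s; rewrite comb3_rot inE.
Qed.

Lemma vertical_notin_slopes : pt 0 1 0 \notin [set pt 1 c 0 | c in F].
Proof.
have n2 : [|| (0 : F) != 0, (1 : F) != 0 | (0 : F) != 0] by rewrite oner_eq0 !orbT.
apply/imsetP => -[c _]; have n1 : [|| (1 : F) != 0, c != 0 | (0 : F) != 0] by rewrite oner_eq0.
move/esym/(pt_eq ind n1 n2) => [k [/eqP]]; by rewrite mulr0 oner_eq0.
Qed.

Lemma card_points_at_infinity : #|points_on l| = #|F|.+1.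
Proof.
rewrite points_at_infinity cardsU1 vertical_notin_slopes.
by rewrite card_imset; last exact: slope_pt_inj.
Qed.

Lemma affine_ptP Q : (Q \notin points_on l) <-> exists z, Q = affine_pt z.
Proof.
have nz (z : F * F) : [|| z.1 != 0, z.2 != 0 | (1 : F) != 0] by rewrite oner_eq0 !orbT.
have n1 (c : F) : [|| (1 : F) != 0, c != 0 | (0 : F) != 0] by rewrite oner_eq0.
have n2 : [|| (0 : F) != 0, (1 : F) != 0 | (0 : F) != 0] by rewrite oner_eq0 !orbT.
split=> [|[z ->]]; last first.
  rewrite points_at_infinity in_setU1; apply/negP => /predU1P[|/imsetP[c _]].
    by move/(pt_eq ind (nz z) n2) => [k [_ _ /eqP]]; rewrite mulr0 oner_eq0.
  by move/(pt_eq ind (nz z) (n1 c)) => [k [_ _ /eqP]]; rewrite mulr0 oner_eq0.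
have [q q0 ->] := point_of_surj P0 Q; rewrite mem_point_of //.
have [a [b [c qE]]] := comb3_surj ind q; rewrite qE => ql.
have c0 : c != 0.
  apply: contraNneq ql => ->; rewrite /cmb /comb3 scale0r addr0.
  rewrite memvD // memvZ //.
    by rewrite -(comb3_100 u v w) -(mem_line_pt P0 ind) ?oner_eq0.
  by rewrite -(comb3_010 u v w) -(mem_line_pt P0 ind) ?oner_eq0 ?orbT.
exists (a / c, b / c); rewrite /affine_pt /pt /cmb -(pt_scale P0 u v w (a / c) (b / c) 1 c0) mulr1 /=.
by rewrite ![c * _]mulrC !divfK.
Qed.

Lemma card_affine_part (S : {set pg2_point F}) :
  #|[set z | affine_pt z \in S]| = #|S :\: points_on l|.
Proof.
rewrite -(card_imset _ affine_pt_inj); apply: eq_card => Q; rewrite inE.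
apply/imsetP/andP => [[z]|[/affine_ptP[z ->] zS]].
  by rewrite inE => zS ->; split=> //; apply/affine_ptP; exists z.
by exists z; rewrite ?inE.
Qed.

Lemma card_missing_slopes (S : {set pg2_point F}) : pt 0 1 0 \in S ->
  #|[set c | pt 1 c 0 \notin S]| = #|points_on l :\: S|.
Proof.
move=> PS; rewrite -(card_imset _ slope_pt_inj); apply: eq_card => Q.
rewrite in_setD points_at_infinity in_setU1.
apply/imsetP/andP => [[c]|[QS /predU1P[QP|/imsetP[c _ Qc]]]].
- by rewrite inE => cS ->; rewrite cS; split=> //; apply/orP; right; apply: imset_f.
- by rewrite QP PS in QS.
- by exists c; rewrite ?inE -?Qc.
Qed.

Lemma line_through_slope c (m : pg2_line F) : pt 1 c 0 \in points_on m -> m != l ->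
  exists x, forall z, intercept c z = x -> affine_pt z \in points_on m.
Proof.
have n1 : [|| (1 : F) != 0, c != 0 | (0 : F) != 0] by rewrite oner_eq0.
have nx (x : F) : [|| (0 : F) != 0, x != 0 | (1 : F) != 0] by rewrite oner_eq0 !orbT.
(* The points of [n] are (0:1:0) and all (0:x:1). As [m] is not [l], it meets [n] in some (0:x:1),
   which gives the intercept. *)
move=> cm ml; have [n [_ _ nQ]] := pencil_line P0 independent3_swap 0.
have [R [Rm /nQ]] := meet_point m n; rewrite comb3_swap => -[RE|[x]].
  case/eqP: ml; apply: (@line_eq (pt 1 c 0) (pt 0 1 0)) => //.
  - by apply: contraNneq vertical_notin_slopes => <-; apply: imset_f.
  - by rewrite /pt -RE.
  - by rewrite points_at_infinity in_setU1; apply/orP; right; apply: imset_f.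
rewrite comb3_swap => RE; exists x.
have [k [ck kz]] := slope_line c x.
have xk : pt 0 x 1 \in points_on k by apply: (kz (0, x)); rewrite /intercept mul0r subr0.
have -> // : m = k.
apply: (@line_eq (pt 1 c 0) (pt 0 x 1)) => //; last by rewrite /pt -RE.
by apply/eqP => /(pt_eq ind n1 (nx x))[j [/eqP]]; rewrite mulr0 oner_eq0.
Qed.

End LineAtInfinity.

End Coordinates.

Lemma frame_of_line P0 (l : pg2_line F) P Q : P != Q ->
    P \in points_on l -> Q \in points_on l ->
  exists u v w : 'rV[F]_3, [/\ independent3 u v w,
    P = point_of P0 (comb3 u v w 1 0 0) & Q = point_of P0 (comb3 u v w 0 1 0)].
Proof.
have [u u0 ->] := point_of_surj P0 P; have [v v0 ->] := point_of_surj P0 Q.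
rewrite !mem_point_of // => PQ ul vl.
have /subvPn[w _ wl] : ~~ ({: 'rV[F]_3} <= val l)%VS.
  by apply/negP => /dimvS; rewrite dimvf3 dim_line.
exists u, v, w; rewrite comb3_100 comb3_010; split=> // a b c.
move=> E; have c0 : c = 0.
  apply: contraNeq wl => c0.
  have -> : w = c^-1 *: - (a *: u + b *: v).
    by rewrite (addr0_eq E) scalerA mulVf // scale1r.
  by rewrite memvZ // memvN memvD // memvZ.
move: E; rewrite /comb3 c0 scale0r addr0 => E.
have b0 : b = 0.
  apply: contraNeq PQ => b0.
  have vE : v = - (b^-1 * a) *: u.
    rewrite scaleNr -scalerA (_ : a *: u = - (b *: v)); last by apply/eqP; rewrite -addr_eq0 E.
    by rewrite scalerN opprK scalerA mulVf // scale1r.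
  rewrite {1}vE point_of_scale //.
  by apply: contraNneq v0 => k0; rewrite vE k0 scale0r.
split=> //; apply: contraNeq u0 => a0.
by move/eqP: E; rewrite b0 scale0r addr0 scaler_eq0 (negPf a0).
Qed.

End Incidence.

(** * Semiarcs with a long secant *)

Section LongSecant.

Variables (F : finFieldType) (S : {set pg2_point F}) (t : nat) (l : pg2_line F).
Hypotheses (t0 : (0 < t)%N) (arcS : semiarc t S).
Hypothesis secant : #|points_on l :&: S| = (#|F| + 1 - t)%N.

(* The [q + 1 - t] lines joining [A] to the points of [l] in [S] are not tangents,
   so the tangents at [A] are precisely the [t] lines to the other points of [l]. *)
Lemma join_complement_tangent A B Q m : (t <= #|F|)%N -> #|points_on l| = #|F|.+1 ->
  A \in S -> A \notin points_on l -> Q \in points_on l -> Q \notin S ->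
  A \in points_on m -> Q \in points_on m -> B \in S -> B \in points_on m -> B = A.
Proof.
move=> tq lq AS Al Ql QS Am Qm BS Bm; apply: contraTeq isT => BA.
have [R HR] := fin_all_exists (fun n => meet_point n l).
have neqA n : R n != A by apply: contraNneq Al => <-; case: (HR n).
have Rinj : {in tangents S A &, injective R}.
  move=> n n' /tangentP[_ An _] /tangentP[_ An' _] RE.
  have [Rn _] := HR n; have [Rn' _] := HR n'.
  by apply: (line_eq (neqA n)) => //; rewrite RE.
(* If B differs from A, then [m] is not a tangent, so no tangent at A passes through Q. The t
   tangents would then inject into t - 1 points. *)
have Rsub : R @: tangents S A \subset (points_on l :\: S) :\ Q.
  apply/subsetP => _ /imsetP[n nT ->]; have [Rn Rl] := HR n.
  have /tangentP[_ An uniqA] := nT.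
  rewrite in_setD1 in_setD Rl andbT; apply/andP; split; last first.
    by apply: contra (neqA n) => RS; rewrite (uniqA _ RS Rn).
  apply: contraNneq BA => RQ; apply/eqP/uniqA => //.
  have -> // : n = m.
  apply: (@line_eq _ A Q) => //; last by rewrite -RQ.
  by apply: contraNneq Al => ->.
have lSt : #|points_on l :\: S| = t.
  by rewrite cardsD lq secant -(addn1 #|F|) subKn // (leq_trans tq) ?leq_addr.
have := cardsD1 Q (points_on l :\: S); rewrite in_setD QS Ql lSt => tE.
have := subset_leq_card Rsub; rewrite card_in_imset // (proj2 arcS) //.
by rewrite {1}tE ltnn.
Qed.

(** Two points of S on [l] serve as slope 0 and the vertical direction. As t > 0 there is a slope in
    N; lines of that slope meet U at most once, so |U| <= q. If |U| = q, all affine lines with slope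
    in N meet U, and every other line passes through a point of S on [l]. *)
Lemma long_secant_bound : (1 < #|F| - t)%N ->
  [/\ (2 * (#|F| - t) <= #|S :\: points_on l|.+1)%N,
      (#|S :\: points_on l| <= #|F|)%N
    & #|S :\: points_on l| = #|F| -> blocking_set S].
Proof.
move=> qt; have tq : (t <= #|F|)%N by move: qt; lia.
have /card_gt1P[P1 [P2 []]] : (1 < #|points_on l :&: S|)%N by rewrite secant; lia.
move=> /setIP[P1l P1S] /setIP[P2l P2S] P12.
have [u [v [w [ind P1E P2E]]]] := frame_of_line P1 P12 P1l P2l.
pose pt a b c := point_of P1 (comb3 u v w a b c).
rewrite P1E in P1l P1S; rewrite P2E in P2l P2S.
have lcard := card_points_at_infinity ind P1l P2l.
rewrite -(card_affine_part ind P1l P2l).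
set U := [set z | _]; pose N := [set c | pt 1 c 0 \notin S].
have Ncard : #|N| = t.
  rewrite (card_missing_slopes ind P1l P2l P2S) cardsD lcard secant.
  by move: tq; lia.
have slope_l c : pt 1 c 0 \in points_on l.
  rewrite (points_at_infinity ind P1l P2l) in_setU1; apply/orP; right.
  exact: imset_f.
have Ninj : {in N, forall c, {in U &, injective (intercept c)}}.
  move=> c; rewrite inE => cS z z'; rewrite !inE => zS z'S E.
  have [m [cm zm]] := slope_line P1 ind c (intercept c z).
  apply: (affine_pt_inj (P0 := P1) ind); apply/esym.
  apply: (@join_complement_tangent _ _ (pt 1 c 0) m) => //; try exact: zm.
  by apply/(affine_ptP ind P1l P2l); exists z.
(* Intercepts missed by U give tangents at (1:c:0), so at most t of the q intercepts are missed. *)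
have Dimg c : c \notin N -> (#|F| - #|N| <= #|intercept c @: U|)%N.
  rewrite inE negbK => cS; have := slope_tangents ind cS.
  by rewrite (proj2 arcS) // Ncard leq_subLR addnC -(cardsC (intercept c @: U)) leq_add2l.
have Iimg : (#|F| - #|N| <= #|[set z.1 | z in U]|)%N.
  have := vertical_tangents ind P2S.
  by rewrite (proj2 arcS) // Ncard leq_subLR addnC -(cardsC [set z.1 | z in U]) leq_add2l.
have Uq : (#|U| <= #|F|)%N.
  have /card_gt0P[c cN] : (0 < #|N|)%N by rewrite Ncard.
  by rewrite -(card_in_imset (Ninj c cN)) max_card.
split=> // [|Ufull m].
  have := intercept_bound (U := U) (N := N); rewrite Ncard => bound.
  apply: bound => //; first by rewrite inE negbK.
    by move=> c /Dimg; rewrite Ncard.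
  by rewrite -Ncard.
have [->|ml] := eqVneq m l; first by exists (pt 1 0 0).
have [R [Rm Rl]] := meet_point m l.
have [RS|RS] := boolP (R \in S); first by exists R.
move: Rl; rewrite (points_at_infinity ind P1l P2l) in_setU1.
case/predU1P => [RE|/imsetP[c _ RE]]; first by rewrite RE P2S in RS.
have cN : c \in N by rewrite inE; rewrite RE in RS.
rewrite RE in Rm; have [x xm] := line_through_slope ind P1l P2l Rm ml.
have : intercept c @: U = setT.
  by apply/eqP; rewrite eqEcard subsetT (card_in_imset (Ninj c cN)) Ufull cardsT leqnn.
move/setP/(_ x); rewrite inE => /imsetP[z zU xE].
by exists (affine_pt P1 u v w z); [move: zU; rewrite inE | apply: xm].
Qed.

End LongSecant.

(** Since t > 0, there is a tangent at P. It meets [l] in a point different from P, which cannot lie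
    in S. *)
Lemma line_not_subset_semiarc (F : finFieldType) (S : {set pg2_point F}) t P l :
  (0 < t)%N -> semiarc t S -> P \in S -> P \notin points_on l ->
  ~~ (points_on l \subset S).
Proof.
move=> t0 [_ arcS] PS Pl; apply/negP => /subsetP lS.
have := t0; rewrite -(arcS P PS) card_gt0 => /set0Pn[m /tangentP[_ Pm uniqP]].
have [R [Rm Rl]] := meet_point m l.
by case/negP: Pl; rewrite -(uniqP R) // lS.
Qed.

Local Close Scope ring_scope.

Theorem theorem2p4 (F : finFieldType) (q t : nat) (S : {set pg2_point F})
    (hq : #|F| = q) (ht : 0 < t) (hS : semiarc t S)
    (hsec : exists l : pg2_line F, #|points_on l :&: S| = q + 1 - t) :
  q - 1 <= 2 * t /\
  (2 * t = q - 1 ->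
   Redei_type S /\
   forall l : pg2_line F, #|points_on l :&: S| = q + 1 - t -> Redei_line S l).
Proof.
subst q; have [l lS] := hsec; split.
  (* If q - t <= 1, then q - 1 <= t <= 2t; otherwise the secant bounds give 2(q - t) <= q + 1. *)
  have [qt|qt] := leqP (#|F| - t) 1; first by lia.
  by have [] := long_secant_bound ht hS lS qt; lia.
(* Here q = 2t + 1 and t > 0, so q - t = t + 1 >= 2. *)
move=> tq; have qt : 1 < #|F| - t by lia.
(* Now 2(q - t) = q + 1, so the lower and upper bounds on the affine part coincide. *)
have full m : #|points_on m :&: S| = #|F| + 1 - t -> #|S :\: points_on m| = #|F|.
  by move=> mS; have [] := long_secant_bound ht hS mS qt; lia.
have Redei m : #|points_on m :&: S| = #|F| + 1 - t -> Redei_line S m.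
  by move=> mS; rewrite /Redei_line -(cardsID (points_on m) S) (full m mS) setIC.
split=> //; split; last by exists l; apply: Redei.
split=> [|m]; first by have [_ _] := long_secant_bound ht hS lS qt; apply; apply: full.
have [P PS Pm] : exists2 P, P \in S & P \notin points_on m.
  have /card_gt1P[P [Q [/setIP[Pl PS] /setIP[Ql QS] PQ]]] : 1 < #|points_on l :&: S|.
    by rewrite lS; lia.
  have [Pm|Pm] := boolP (P \in points_on m); last by exists P.
  have [Qm|Qm] := boolP (Q \in points_on m); last by exists Q.
  (* Both points lie on [m], so m = l, and a point is taken from the q points of S off [l]. *)
  rewrite (line_eq PQ Pm Qm Pl Ql).
  have /card_gt0P[R /setDP[RS Rl]] : 0 < #|S :\: points_on l| by rewrite full //; lia.
  by exists R.
exact: line_not_subset_semiarc ht hS PS Pm.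
Qed.
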